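(* Let $H$ be an intersecting $r$-partite hypergraph with covering number $\tau$ and maximum degree $\Delta$. Then: $\Delta\ge2$ if $|H|\ge2$; $\Delta\ge3$ if $\tau>(r+1)/2$; $\Delta\ge4$ if $\tau>2r/3+1$; and $\Delta\ge5$ if $\tau\ge(25r+23)/32$.
   Context: $|H|$ denotes the number of edges of $H$. A hypergraph is $r$-partite if its vertex set can be partitioned into $r$ sets (the sides) so that every edge contains exactly one vertex from each side. $H$ is intersecting if every two edges share a vertex. The covering number $\tau$ is the minimum size of a set of vertices meeting every edge; the degree of a vertex is the number of edges containing it. *)

(* Defs.v *)
From mathcomp Require Import all_boot all_order all_algebra.

Set Implicit Arguments.
Unset Strict Implicit.
Unset Printing Implicit Defensive.

(* A hypergraph on the finite vertex type V is its set of edges H : {set {set V}}. *)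

Section Hypergraphs.

Variable V : finType.
Implicit Types (H : {set {set V}}) (C : {set V}) (v : V).

(* The sides are the fibres of [side]. *)
Definition r_partite (r : nat) H : Prop :=
  exists side : V -> 'I_r,
    forall (e : {set V}) (i : 'I_r),
      e \in H -> #|[set v in e | side v == i]| = 1.

(* The case e = f only says that no edge is empty, which r_partite already
   gives when r > 0. *)
Definition intersecting H : Prop :=
  forall e f : {set V}, e \in H -> f \in H -> e :&: f != set0.

Definition vertex_cover H C : bool := [forall e in H, C :&: e != set0].

(* setT is a vertex cover as soon as H has no empty edge, in particular
   whenever H is intersecting. *)
Definition covering_number H : nat :=
  #|[arg min_(C < [set: V] | vertex_cover H C) #|C|]|.

Definition degree H v : nat := #|[set e in H | v \in e]|.

Definition max_degree H : nat := \max_(v : V) degree H v.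

End Hypergraphs.

(* Main.v *)
Require Import Defs.
From mathcomp Require Import all_boot all_order all_algebra.
From mathcomp Require Import zify lra.

(**
  Let n = |H|, write d(v) for degrees, and fix a side.  The vertices of positive
  degree on it form a cover, so tau <= n - sum (d(v) - 1).  The vertices of degree
  at least 3 on it, completed by one common vertex for each pair of the remaining
  edges, give 2 tau <= n + 1 - sum (d(v) - 2).  If c satisfies
  d (d - 1) <= 2 (d - 1) + c (d - 2) for all degrees that occur, then adding
  these bounds over the r sides and using n (n - 1) <= sum d(v) (d(v) - 1), which
  holds because every two edges meet, gives
  n (n - 1) <= r (2 (n - tau) + c (n + 1 - 2 tau)).
  One may take c = 0, 2, 3 for maximum degree 2, 3, 4; the resulting quadratic
  in n is maximised near n = r, 2 r, 5 r / 2 respectively.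
*)

Set Implicit Arguments.
Unset Strict Implicit.
Unset Printing Implicit Defensive.

Section Covers.

Variable V : finType.
Implicit Types (H : {set {set V}}) (C S e f : {set V}) (v : V).

Lemma covering_number_le H C :
  intersecting H -> vertex_cover H C -> covering_number H <= #|C|.
Proof.
move=> iH hC; rewrite /covering_number; case: arg_minnP => [|C0 _]; last exact.
by apply/forall_inP => e eH; rewrite setTI -(setIid e) iH.
Qed.

Lemma intersecting_sub H H' : H' \subset H -> intersecting H -> intersecting H'.
Proof. by move=> /subsetP sub iH e f /sub eH /sub fH; apply: iH. Qed.

(** Edges are removed two at a time, each pair costing one common vertex; the successor pays for the
    edge left over when [#|H|] is odd. *)
Lemma intersecting_cover_half H :
  intersecting H -> exists2 C, vertex_cover H C & 2 * #|C| <= #|H|.+1.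
Proof.
have [m] := ubnP #|H|; elim: m H => // m IHm H ltHm iH.
have [-> | [e eH]] := set_0Vmem H.
  by exists set0; rewrite ?cards0 //; apply/forall_inP => f; rewrite inE.
have cardH : #|H| = #|H :\ e|.+1 by rewrite (cardsD1 e H) eH.
have [He0 | [f fHe]] := set_0Vmem (H :\ e).
  (* Only [e] is left; it is nonempty because it meets itself. *)
  have /set0Pn[v] := iH e e eH eH; rewrite setIid => ve.
  exists [set v]; last by rewrite cards1 cardH.
  apply/forall_inP => f fH; apply/set0Pn; exists v; rewrite !inE eqxx /=.
  have [->//|ne] := eqVneq f e.
  by have := in_set0 f; rewrite -He0 !inE ne fH.
have fH : f \in H by move: fHe; rewrite inE => /andP[].
have cardHe : #|H :\ e| = #|H :\ e :\ f|.+1 by rewrite (cardsD1 f) fHe.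
have /set0Pn[v] := iH e f eH fH; rewrite inE => /andP[ve vf].
have subH : H :\ e :\ f \subset H.
  by apply/subsetP => g; rewrite !inE => /and3P[].
have [|C covC cardC] := IHm (H :\ e :\ f) _ (intersecting_sub subH iH).
  by lia.
exists (v |: C); last by rewrite cardsU1 cardH cardHe; case: (v \notin C); lia.
apply/forall_inP => g gH; apply/set0Pn.
have [->|ge] := eqVneq g e; first by exists v; rewrite !inE eqxx ve.
have [->|gf] := eqVneq g f; first by exists v; rewrite !inE eqxx vf.
have /set0Pn[w] : C :&: g != set0.
  by apply: (forall_inP covC); rewrite !inE gf ge gH.
by rewrite inE => /andP[wC wg]; exists w; rewrite !inE wC wg orbT.
Qed.

Lemma covering_number_le_half H S : intersecting H ->
  2 * covering_number H <= 2 * #|S| + #|[set e in H | S :&: e == set0]|.+1.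
Proof.
move=> iH; set M := [set e in H | _].
have subM : M \subset H by apply/subsetP => e; rewrite inE => /andP[].
have [C covC cardC] := intersecting_cover_half (intersecting_sub subM iH).
have : covering_number H <= #|S :|: C|.
  apply: covering_number_le => //; apply/forall_inP => e eH.
  rewrite setIUl setU_eq0 negb_and.
  have [Se|//] := eqVneq (S :&: e) set0.
  by apply: (forall_inP covC); rewrite inE eH Se eqxx.
by have [+ _] := leq_card_setU S C; lia.
Qed.

(** Double counting of incidences, used below with [F] constantly 1 and with [F] the degree minus
    one. *)
Lemma sum_degree_mul H (P : pred V) (F : V -> nat) :
  \sum_(v | P v) degree H v * F v = \sum_(e in H) \sum_(v in e | P v) F v.
Proof.
rewrite (exchange_big_dep P) /=; last by move=> e v _ /andP[].
apply: eq_bigr => v Pv; rewrite sum_nat_const; congr (_ * _).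
by apply: eq_card => e; rewrite inE [RHS]unfold_in /= Pv andbT.
Qed.

Lemma degree_le_max H v : degree H v <= max_degree H.
Proof. exact: leq_bigmax. Qed.

(** Every other edge meets [e], so it is counted at one or more vertices of [e]. *)
Lemma sum_degree_pred_edge H e : intersecting H -> e \in H ->
  #|H|.-1 <= \sum_(v in e) (degree H v).-1.
Proof.
move=> iH eH.
have -> : #|H|.-1 = \sum_(f in H :\ e) 1 by rewrite sum1_card (cardsD1 e H) eH.
have -> : \sum_(v in e) (degree H v).-1 =
          \sum_(v in e) \sum_(f in H :\ e | v \in f) 1.
  apply: eq_bigr => v ve; rewrite sum1_card /degree (cardsD1 e) inE eH ve /=.
  by apply: eq_card => f; rewrite [RHS]unfold_in /= !inE andbA.
rewrite (exchange_big_dep [in H :\ e]) /=; last by move=> v f _ /andP[].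
apply: leq_sum => f fHe; rewrite sum1_card.
have fH : f \in H by move: fHe; rewrite inE => /andP[].
have /set0Pn[v] := iH e f eH fH; rewrite inE => /andP[ve vf].
by apply/card_gt0P; exists v; rewrite unfold_in /= ve fHe.
Qed.

Lemma sum_degree_pairs H : intersecting H ->
  #|H| * #|H|.-1 <= \sum_v degree H v * (degree H v).-1.
Proof.
move=> iH; rewrite sum_degree_mul -sum_nat_const.
apply: leq_sum => e eH; apply: leq_trans (sum_degree_pred_edge iH eH) _.
by rewrite leq_eqVlt; apply/orP; left; apply/eqP/eq_bigl => v; rewrite andbT.
Qed.

End Covers.

Section Partite.

Variables (V : finType) (r : nat) (H : {set {set V}}) (side : V -> 'I_r).
Hypothesis sideP : forall (e : {set V}) (i : 'I_r),
  e \in H -> #|[set v in e | side v == i]| = 1.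
Hypothesis iH : intersecting H.

Local Notation d := (degree H).
Local Notation tau := (covering_number H).

Lemma side_degree_sum i : \sum_(v | side v == i) d v = #|H|.
Proof.
have := sum_degree_mul H (fun v => side v == i) (fun=> 1).
under eq_bigr do rewrite muln1.
move=> ->; rewrite -sum1_card; apply: eq_bigr => e eH.
by rewrite sum1_card -(sideP i eH); apply: eq_card => v; rewrite !inE.
Qed.

Lemma side_cover i : tau + \sum_(v | side v == i) (d v).-1 <= #|H|.
Proof.
pose S := [set v | (side v == i) && (0 < d v)].
have covS : vertex_cover H S.
  apply/forall_inP => e eH; apply/set0Pn.
  have /card_gt0P[v] : 0 < #|[set v in e | side v == i]| by rewrite sideP.
  rewrite inE => /andP[ve vi]; exists v; rewrite !inE vi ve /= andbT.
  by apply/card_gt0P; exists e; rewrite inE eH.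
apply: leq_trans (leq_add (covering_number_le iH covS) (leqnn _)) _.
have -> : #|S| = \sum_(v | side v == i) (0 < d v).
  rewrite -sum1_card big_mkcond [RHS]big_mkcond.
  by apply: eq_bigr => v _; rewrite inE; case: (side v == i); case: (0 < d v).
rewrite -big_split /= -(side_degree_sum i).
by apply: leq_sum => v _; case: (d v).
Qed.

Lemma side_mixed_cover i :
  2 * tau + \sum_(v | side v == i) (d v - 2) <= #|H|.+1.
Proof.
pose S := [set v | (side v == i) && (2 < d v)].
have := covering_number_le_half S iH.
set M := [set e in H | _] => leT.
(* An edge has one vertex on side [i], so it is counted at most once by the degrees over [S], and
   not at all if it lies in [M]. *)
have leM : \sum_(v in S) d v + #|M| <= #|H|.
  have := sum_degree_mul H (mem S) (fun=> 1).
  under eq_bigr do rewrite muln1.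
  have -> : #|M| = \sum_(e in H) (S :&: e == set0).
    rewrite -sum1_card big_mkcond [RHS]big_mkcond.
    by apply: eq_bigr => e _; rewrite inE; case: (e \in H); case: eqP.
  move=> /= ->; rewrite -big_split /= -sum1_card; apply: leq_sum => e eH.
  rewrite sum1_card; set A := (X in #|X|).
  have eA : #|A| = #|S :&: e|.
    by apply: eq_card => v; rewrite inE unfold_in /= andbC.
  rewrite eA; have [->|_] := eqVneq (S :&: e) set0; first by rewrite cards0.
  rewrite addn0 -(sideP i eH); apply/subset_leq_card/subsetP => v.
  by rewrite !inE => /andP[/andP[-> _] ->].
have eS : \sum_(v in S) d v = 2 * #|S| + \sum_(v | side v == i) (d v - 2).
  (* Truncated subtraction makes the terms with degree at most 2 vanish. *)
  have -> : \sum_(v | side v == i) (d v - 2) = \sum_(v in S) (d v - 2).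
    rewrite big_mkcond [RHS]big_mkcond; apply: eq_bigr => v _.
    by rewrite inE; case: (side v == i) => //=; case: ltnP => // ?; lia.
  rewrite mulnC -sum_nat_const -big_split /=; apply: eq_bigr => v.
  by rewrite inE => /andP[_ ?]; lia.
by lia.
Qed.

(** The terms in [tau] stand on the left so that no truncated subtraction occurs. *)
Lemma card_edges_pairs_le (c : nat) :
  (forall v, d v * (d v).-1 <= 2 * (d v).-1 + c * (d v - 2)) ->
  #|H| * #|H|.-1 + r * (2 * tau + c * (2 * tau))
    <= r * (2 * #|H| + c * #|H|.+1).
Proof.
move=> hc; apply: leq_trans (leq_add (sum_degree_pairs iH) (leqnn _)) _.
rewrite (partition_big side predT) //=.
have sum_r m : r * m = \sum_(i < r) m by rewrite sum_nat_const card_ord.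
rewrite !sum_r -big_split /=.
apply: leq_sum => i _.
have le_pairs : \sum_(v | side v == i) d v * (d v).-1 <=
   2 * \sum_(v | side v == i) (d v).-1 + c * \sum_(v | side v == i) (d v - 2).
  by rewrite !big_distrr -big_split /=; apply: leq_sum => v _; apply: hc.
apply: leq_trans (leq_add le_pairs (leqnn _)) _; rewrite addnACA -!mulnDr.
by rewrite leq_add ?leq_mul // addnC ?side_cover ?side_mixed_cover.
Qed.

(** A vertex would have a side in the empty type ['I_0], so a nonempty edge is impossible. *)
Lemma covering_number_r0 : r = 0 -> tau = 0.
Proof.
move=> r0; apply/eqP; rewrite -leqn0.
have -> : 0 = #|@set0 V| by rewrite cards0.
apply: covering_number_le => //; apply/forall_inP => e eH.
have /set0Pn[v _] := iH eH eH.
by case: (side v) => k; rewrite r0.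
Qed.

End Partite.

Import GRing.Theory Num.Theory.
Local Open Scope ring_scope.

Theorem theorem7 (V : finType) (r : nat) (H : {set {set V}})
    (H_partite : r_partite r H) (H_intersecting : intersecting H) :
  [/\ (2 <= #|H|)%N -> (2 <= max_degree H)%N,
      (r%:R + 1) / 2 < (covering_number H)%:R :> rat -> (3 <= max_degree H)%N,
      2 * r%:R / 3 + 1 < (covering_number H)%:R :> rat -> (4 <= max_degree H)%N
    & (25 * r%:R + 23) / 32 <= (covering_number H)%:R :> rat ->
      (5 <= max_degree H)%N].
Proof.
have [side sideP] := H_partite.
have key := card_edges_pairs_le sideP H_intersecting.
have r_gt0 : (0 < covering_number H -> 0 < r)%N.
  by case: (posnP r) => // /(covering_number_r0 side H_intersecting) ->.
have deg_le := degree_le_max H.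
split.
- move=> /card_gt1P[e [f [eH fH nef]]].
  have /set0Pn[v] := H_intersecting e f eH fH; rewrite inE => /andP[ve vf].
  apply: leq_trans (deg_le v); apply/card_gt1P.
  by exists e, f; rewrite !inE eH fH.
- move=> lt_tau; have {}lt_tau : (r + 1 < 2 * covering_number H)%N.
    by rewrite -(ltr_nat rat) natrD natrM; lra.
  rewrite ltnNge; apply/negP => le2.
  have /key : forall v, (degree H v * (degree H v).-1
      <= 2 * (degree H v).-1 + 0 * (degree H v - 2))%N.
    move=> v; move: (leq_trans (deg_le v) le2).
    by case: (degree H v) => [|[|[|]]].
  have {}r_gt0 : (0 < r)%N by apply: r_gt0; lia.
  move: lt_tau; move: (covering_number H) #|H| => t n lt_tau.
  have := leq_mul (leqnn r) lt_tau; case: n => [|n]; first nia.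
  (* Now [#|H|] is [n.+1], and [r + 2 <= 2 * t] reduces [key] to n^2 + n + r^2 <= 2nr. As 2nr <= n^2
     + r^2, this forces n = 0 and then r = 0. *)
  have [+ _] := nat_Cauchy n r; rewrite -!mulnn /=; case: n => [|n]; nia.
- move=> lt_tau; have {}lt_tau : (2 * r + 3 < 3 * covering_number H)%N.
    by rewrite -(ltr_nat rat) natrD !natrM; lra.
  rewrite ltnNge; apply/negP => le3.
  have /key : forall v, (degree H v * (degree H v).-1
      <= 2 * (degree H v).-1 + 2 * (degree H v - 2))%N.
    move=> v; move: (leq_trans (deg_le v) le3).
    by case: (degree H v) => [|[|[|[|]]]].
  have {}r_gt0 : (0 < r)%N by apply: r_gt0; lia.
  move: lt_tau; move: (covering_number H) #|H| => t n lt_tau.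
  have := leq_mul (leqnn r) lt_tau; case: n => [|n]; first nia.
  (* Here [key] becomes n^2 + n + 4r^2 + 2r <= 4nr, against 4nr <= n^2 + 4r^2. *)
  have [+ _] := nat_Cauchy n (2 * r); rewrite -!mulnn /=; nia.
- move=> le_tau; have {}le_tau : (25 * r + 23 <= 32 * covering_number H)%N.
    by rewrite -(ler_nat rat) natrD !natrM; lra.
  rewrite ltnNge; apply/negP => le4.
  have /key : forall v, (degree H v * (degree H v).-1
      <= 2 * (degree H v).-1 + 3 * (degree H v - 2))%N.
    move=> v; move: (leq_trans (deg_le v) le4).
    by case: (degree H v) => [|[|[|[|[|]]]]].
  have {}r_gt0 : (0 < r)%N by apply: r_gt0; lia.
  move: le_tau; move: (covering_number H) #|H| => t n le_tau.
  have := leq_mul (leqnn r) le_tau; case: n => [|n]; first nia.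
  (* Four times [key] gives 4n^2 + 4n + 25r^2 <= 20nr + 9r; comparing with the square of (2n + 1) -
     5r leaves r <= 1. For r = 1 integrality gives [2 <= t], hence n^2 + 8 <= 4n, against 4n <= n^2
     + 4. *)
  have [+ _] := nat_Cauchy (2 * n).+1 (5 * r); have [+ _] := nat_Cauchy n 2.
  clear -r_gt0 le_tau; rewrite -!mulnn /=; case: r r_gt0 le_tau => [|[|r]] //; nia.
Qed.
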